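(* Let $D=\sum_j a_j\{p_j\}+a\{\infty\}$ be an Arakelov divisor on $\overline{\mathrm{Spec}\,\mathbb{Z}}$. The following facts hold (for all integers $k\ge 0$): (i) $\pi_1(\mathbf{H}(D))=\|HL\|_{e^a}$ as $\mathbb{S}$-modules, with $L=H^0(\mathrm{Spec}\,\mathbb{Z},\mathcal{O}(D_{\mathrm{finite}}))$. (ii) $\#\pi_1(\mathbf{H}(D)(k_+))=\gamma(n,k)$ for $n=\mathrm{IntegerPart}(e^{\deg(D)})$. (iii) $\pi_0(\mathbf{H}(D)(k_+))=*\iff k\le2e^{\deg(D)}$. (iv) $\pi_n(\mathbf{H}(D)(k_+))$ is trivial for $n>1$.
   Context: Arakelov divisors: $D=\sum_j a_j\{p_j\}+a\{\infty\}$ is a finite formal sum, $p_j$ distinct primes, $a_j\in\mathbb{Z}$, $a\in\mathbb{R}$; $\deg D=\sum_j a_j\log p_j+a$, $D_{\mathrm{finite}}=\sum_ja_j\{p_j\}$. Put $\lambda=e^a$ and $L=H^0(\mathrm{Spec}\,\mathbb{Z},\mathcal{O}(D_{\mathrm{finite}}))=\{q\in\mathbb{Q}:|q|_{p_j}\le p_j^{a_j}\ \forall j,\ |q|_p\le1\text{ for all other primes }p\}\subset\mathbb{R}$. $\Gamma^{\mathrm{op}}$ is the category of pointed sets $k_+=\{0,\dots,k\}$ (base point $0$) and pointed maps; an $\mathbb{S}$-module is a pointed covariant functor from $\Gamma^{\mathrm{op}}$ to pointed sets. For an abelian group $A$, $HA$ is the $\mathbb{S}$-module $HA(k_+)=A^k$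 (functions on $k_+\setminus\{0\}$), with $HA(f)(\phi)(y)=\sum_{f(x)=y}\phi(x)$ for $y\neq 0$. For a subgroup $A\subset\mathbb{R}$ and $\mu>0$ or $\mu=0$, $\|HA\|_\mu\subset HA$ is the $\mathbb{S}$-submodule $\|HA\|_\mu(k_+)=\{\phi\in A^k:\sum_x|\phi(x)|\le\mu\}$. For integers $n,k\ge0$, $\gamma(n,k):=\#\big(\|H\mathbb{Z}\|_n(k_+)\big)$. $\Delta^{\mathrm{op}}$ is identified with the category of finite intervals $[n]^*=\{0,\dots,n+1\}$ and non-decreasing maps preserving smallest and largest elements; the dual of $\theta\in\mathrm{Hom}_\Delta([n],[m])$ is $\theta^*:[m]^*\to[n]^*$ with $j\le\theta(i)\iff\theta^*(j)\le i$. Let $\phi:\mathbb{R}\to\mathbb{R}/L$ be the quotient map. For a pair of finite pointed sets $*\in Y\subset X$, $K_{L,\lambda}(X,Y)$ is the set of functions $\psi$ on $X\setminus\{*\}$ with $\psi(x)\in\mathbb{R}$ for $x\in X\setminus Y$, $\psi(y)\in\mathbb{R}/L$ for $y\in Y\setminus\{*\}$, and $\sum_{x\in X\setminus Y}|\psi(x)|\le\lambda$; its base point is $\psi=0$. A pointed map $f:X\to X'$ with $f(Y)\subset Y'$ acts by $\psi\mapsto\psi'$, $\psi'(y)=\sum_{f(x)=y}\psi(x)$ for $y\in X'\setminus Y'$, and $\psi'(y)=\sum_{x\ne *,f(x)=y}p(\psi(x))$ for $y\in Y'\setminus\{*\}$, where $p=\phi$ on $\mathbb{R}$-values and $p=\mathrm{id}$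 on $\mathbb{R}/L$-values. $\mathbf{H}(D)$ is the simplicial $\mathbb{S}$-module ($\Gamma$-space) for which $\mathbf{H}(D)(k_+)$ is the pointed simplicial set with $n$-simplices $K_{L,\lambda}(X_n\wedge k_+,Y_n\wedge k_+)$, where $X_n=[n]^*$ pointed by $0$ and $Y_n=\{0,n+1\}$, with functoriality induced from $\theta\mapsto\theta^*$ and from $k_+$. Homotopy (the simplicial sets need not be Kan): for a pointed simplicial set $(X,* )$, with $*$ also denoting its degeneracies, $\pi_n(X)$ is the set $\{x\in X_n:\partial_jx=*\ \forall j\}$ of spherical $n$-simplices (all of $X_0$ for $n=0$) together with the relation $\mathcal{R}$ (not an equivalence relation in general): $(x,y)\in\mathcal{R}$ iff there is $z\in X_{n+1}$ with $\partial_jz=*$ for $j<n$, $\partial_nz=x$, $\partial_{n+1}z=y$. When $\mathcal{R}$ is an equivalence relation $\pi_n(X)$ is identified with the quotient set. $\pi_n(X)=*$ (trivial) means that any two spherical $n$-simplices are related by $\mathcal{R}$. $\pi_1(\mathbf{H}(D))$ is the functor $k_+\mapsto\pi_1(\mathbf{H}(D)(k_+))$. *)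

(* Defs.v *)
From Stdlib Require Import Relations.
From HB Require Import structures.
From mathcomp Require Import all_boot all_order all_algebra finmap.
From mathcomp Require Import mathcomp_extra boolp classical_sets functions.
From mathcomp Require Import cardinality reals interval_inference sequences exp.
From mathcomp Require Import zify.

Set Implicit Arguments.
Unset Strict Implicit.
Unset Printing Implicit Defensive.

Import Order.TTheory GRing.Theory Num.Theory.
Local Open Scope ring_scope.

(* Pointed sets are the library's pointedType, with base point [point].       *)

#[short(type="finPointedType")]
HB.structure Definition FinPointed := {T of Finite T & isPointed T}.

(* This also makes the interval [n]^* = 'I_n.+2 a pointed set based at 0.     *)
HB.instance Definition _ k := isPointed.Build 'I_k.+1 ord0.

Definition kplus (k : nat) : finPointedType := 'I_k.+1.

Record pmap (X Y : pointedType) := Pmap {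
  pmap_fun :> X -> Y;
  pmap_pt : pmap_fun point = point }.

Definition pid (X : pointedType) : pmap X X := @Pmap X X idfun erefl.

Lemma pcomp_pt (X Y Z : pointedType) (g : pmap Y Z) (f : pmap X Y) :
  g (f point) = point.
Proof. by rewrite !pmap_pt. Qed.

Definition pcomp (X Y Z : pointedType) (g : pmap Y Z) (f : pmap X Y) :
  pmap X Z := @Pmap X Z (g \o f) (pcomp_pt g f).

Definition nonbase (X : pointedType) := {x : X | x != point}.
HB.instance Definition _ (X : finPointedType) := Finite.on (nonbase X).

Record smodule := Smodule {
  sm_ob :> nat -> pointedType;
  sm_map : forall k l, pmap (kplus k) (kplus l) -> pmap (sm_ob k) (sm_ob l);
  sm_id : forall k (x : sm_ob k), sm_map (pid (kplus k)) x = x;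
  sm_comp : forall k l m (g : pmap (kplus l) (kplus m))
      (f : pmap (kplus k) (kplus l)) (x : sm_ob k),
    sm_map (pcomp g f) x = sm_map g (sm_map f x);
  sm_pointed : forall x : sm_ob 0, x = point }.

Definition smodule_iso (M N : smodule) : Prop :=
  exists F : forall k, pmap (M k) (N k),
    (forall k, bijective (F k)) /\
    (forall k l (f : pmap (kplus k) (kplus l)) (x : M k),
       F l (sm_map M f x) = sm_map N f (F k x)).

Section FiberSums.

Lemma sum_sub (V : nmodType) (J : finType) (P : pred J) (Q : pred J)
    (h : J) (c : V) :
  \sum_(y : {y : J | P y} | (h == val y) && Q (val y)) c =
  if P h && Q h then c else 0.
Proof.
case: ifPn => [/andP[Ph Qh]|nPQ].
  rewrite (big_pred1 (exist _ h Ph)) // => y /=.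
  rewrite -val_eqE /=; apply/andP/eqP => [[/eqP-> _]//|->].
  by rewrite eqxx Qh.
rewrite big_pred0 // => y; apply/negbTE; apply: contra nPQ => /andP[/eqP-> ->].
by rewrite (valP y).
Qed.

Lemma fiber_sum (V : nmodType) (I J : finType) (P Q : pred J)
    (h : I -> J) (F : I -> V) :
  \sum_(y : {y : J | P y} | Q (val y)) \sum_(x | h x == val y) F x =
  \sum_(x | P (h x) && Q (h x)) F x.
Proof.
rewrite (exchange_big_dep xpredT) //= [RHS]big_mkcond; apply: eq_bigr => x _.
by rewrite -sum_sub; apply: eq_bigl => y; rewrite andbC.
Qed.

Lemma fiber_norm (R : realType) (I J : finType) (P : pred J)
    (h : I -> J) (F : I -> R) :
  \sum_(y : {y : J | P y}) `|\sum_(x | h x == val y) F x| <= \sum_x `|F x|.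
Proof.
apply: (@le_trans _ _ (\sum_(y : {y : J | P y})
          \sum_(x | h x == val y) `|F x|)).
  by apply: ler_sum => y _; apply: ler_norm_sum.
rewrite (fiber_sum P xpredT) [leRHS](bigID (fun x => P (h x) && true)) /=.
by rewrite lerDl sumr_ge0.
Qed.

End FiberSums.

Section EilenbergMacLane.
Variable A : zmodType.

Definition HA (k : nat) := {ffun nonbase (kplus k) -> A}.
HB.instance Definition _ k := GRing.Zmodule.on (HA k).
HB.instance Definition _ k := isPointed.Build (HA k) 0.

Definition HA_fun k l (f : pmap (kplus k) (kplus l)) (phi : HA k) : HA l :=
  [ffun y => \sum_(x | f (val x) == val y) phi x].

Lemma HA_pt k l (f : pmap (kplus k) (kplus l)) : HA_fun f point = point.
Proof. by apply/ffunP => y; rewrite !ffunE big1 // => x _; rewrite ffunE. Qed.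

Lemma HA_id k (phi : HA k) : HA_fun (pid _) phi = phi.
Proof.
apply/ffunP => y; by rewrite ffunE (big_pred1 y).
Qed.

Lemma HA_comp k l m (g : pmap (kplus l) (kplus m))
    (f : pmap (kplus k) (kplus l)) (phi : HA k) :
  HA_fun (pcomp g f) phi = HA_fun g (HA_fun f phi).
Proof.
apply/ffunP => y; rewrite !ffunE.
under [RHS]eq_bigr do rewrite ffunE.
rewrite (fiber_sum _ (fun z => g z == val y) (fun x => f (val x))).
apply: eq_bigl => x /=; case: eqVneq => [gf|]; last by rewrite andbF.
rewrite andbT; apply/esym; apply: contraNneq (valP y) => fx.
by move: gf; rewrite fx pmap_pt => gf; apply/eqP/esym.
Qed.

Lemma nonbase0 (x : nonbase (kplus 0)) : False.
Proof. by case: x => x; rewrite ord1. Qed.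

Lemma HA_pointed (phi : HA 0) : phi = point.
Proof. by apply/ffunP => x; case: (nonbase0 x). Qed.

Definition HA_smodule : smodule :=
  @Smodule HA (fun k l f => Pmap (HA_pt f)) HA_id HA_comp HA_pointed.

End EilenbergMacLane.

Definition subgroup (V : zmodType) (A : zmodClosed V) := {x : V | x \in A}.
HB.instance Definition _ (V : zmodType) (A : zmodClosed V) :=
  SubChoice.on (subgroup A).
HB.instance Definition _ (V : zmodType) (A : zmodClosed V) :=
  [SubChoice_isSubZmodule of subgroup A by <:].

Lemma subgroup_sum (V : zmodType) (A : zmodClosed V) (I : finType)
    (P : pred I) (F : I -> subgroup A) :
  val (\sum_(i | P i) F i) = \sum_(i | P i) val (F i).
Proof. exact: (raddf_sum (val : subgroup A -> V)). Qed.

Section NormedEilenbergMacLane.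
Variables (R : realType) (A : zmodClosed R) (mu : {nonneg R}).

Definition norm_le k (phi : HA (subgroup A) k) : bool :=
  \sum_x `|val (phi x)| <= mu%:num.

Definition normHA (k : nat) := {phi : HA (subgroup A) k | norm_le phi}.

Lemma norm_le0 k : norm_le (point : HA (subgroup A) k).
Proof. by rewrite /norm_le big1 // => x _; rewrite ffunE /= normr0. Qed.

HB.instance Definition _ k := Choice.on (normHA k).
HB.instance Definition _ k :=
  isPointed.Build (normHA k) (exist _ point (norm_le0 k)).

Lemma norm_le_map k l (f : pmap (kplus k) (kplus l)) (phi : normHA k) :
  norm_le (HA_fun f (val phi)).
Proof.
apply: le_trans (valP phi); rewrite /norm_le.
under eq_bigr do rewrite ffunE subgroup_sum.
exact: (fiber_norm _ (fun x : nonbase (kplus k) => f (val x))).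
Qed.

Definition normHA_fun k l (f : pmap (kplus k) (kplus l)) (phi : normHA k) :
  normHA l := exist _ (HA_fun f (val phi)) (norm_le_map f phi).

Lemma normHA_pt k l (f : pmap (kplus k) (kplus l)) :
  normHA_fun f point = point.
Proof. by apply: val_inj; apply: HA_pt. Qed.

Lemma normHA_id k (phi : normHA k) : normHA_fun (pid _) phi = phi.
Proof. by apply: val_inj; apply: HA_id. Qed.

Lemma normHA_comp k l m (g : pmap (kplus l) (kplus m))
    (f : pmap (kplus k) (kplus l)) (phi : normHA k) :
  normHA_fun (pcomp g f) phi = normHA_fun g (normHA_fun f phi).
Proof. by apply: val_inj; apply: HA_comp. Qed.

Lemma normHA_pointed (phi : normHA 0) : phi = point.
Proof. by apply: val_inj; apply: HA_pointed. Qed.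

Definition normHA_smodule : smodule :=
  @Smodule normHA (fun k l f => Pmap (normHA_pt f))
    normHA_id normHA_comp normHA_pointed.

End NormedEilenbergMacLane.

(* The category Delta: [n] is 'I_n.+1, its maps are order morphisms.          *)

Definition dmap (m n : nat) := {omorphism 'I_m.+1 -> 'I_n.+1}.

Record psset := PSSet {
  ss_ob :> nat -> pointedType;
  ss_map : forall m n, dmap m n -> pmap (ss_ob n) (ss_ob m);
  ss_id : forall n (x : ss_ob n), ss_map (idfun : dmap n n) x = x;
  ss_comp : forall m n p (theta : dmap n p) (eta : dmap m n) (x : ss_ob p),
    ss_map (theta \o eta : dmap m p) x = ss_map eta (ss_map theta x) }.

Record pssmap (X Y : psset) := PSSMap {
  pss_fun :> forall n, pmap (X n) (Y n);
  pss_nat : forall m n (theta : dmap m n) (x : X n),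
    pss_fun m (ss_map X theta x) = ss_map Y theta (pss_fun n x) }.

(* A simplicial S-module, as a functor from the k_+ to pointed simplicial     *)
(* sets.                                                                      *)
Record gspace := GSpace {
  gs_ob :> nat -> psset;
  gs_map : forall k l, pmap (kplus k) (kplus l) -> pssmap (gs_ob k) (gs_ob l);
  gs_id : forall k n (x : gs_ob k n), gs_map (pid (kplus k)) n x = x;
  gs_comp : forall k l m (g : pmap (kplus l) (kplus m))
      (f : pmap (kplus k) (kplus l)) n (x : gs_ob k n),
    gs_map (pcomp g f) n x = gs_map g n (gs_map f n x);
  gs_pointed : forall n (x : gs_ob 0 n), x = point }.

Section Homotopy.

Lemma lift_homo n (j : 'I_n.+2) :
  {homo (lift j : 'I_n.+1 -> 'I_n.+2) : a b / (a <= b)%O}.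
Proof.
move=> a b; rewrite !leEord /= /bump => ab.
by case: (leqP j a) => ja; [rewrite (leq_trans ja ab)|rewrite leq_add ?leq0n].
Qed.

HB.instance Definition _ n (j : 'I_n.+2) :=
  Order.isOrderMorphism.Build _ 'I_n.+1 _ 'I_n.+2
    (lift j : 'I_n.+1 -> 'I_n.+2) (@lift_homo n j).

Definition coface n (j : 'I_n.+2) : dmap n n.+1 := lift j.

Definition face (X : psset) n (j : 'I_n.+2) : pmap (X n.+1) (X n) :=
  ss_map X (coface j).

Definition spherical (X : psset) n : pred (X n) :=
  match n with
  | 0 => xpredT
  | m.+1 => fun x => [forall j : 'I_m.+2, face X j x == point]
  end.

Definition sph (X : psset) n := {x : X n | spherical x}.

Definition piR (X : psset) n : relation (sph X n) := fun x y =>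
  exists z : X n.+1,
    [/\ forall j : 'I_n.+2, (j < n)%N -> face X j z = point,
        face X (inord n) z = val x &
        face X ord_max z = val y].

Definition pi_trivial (X : psset) n : Prop := forall x y : sph X n, piR x y.

(* The quotient by the equivalence relation generated by piR, which is piR    *)
(* itself when that is already an equivalence relation.                       *)

Lemma ss_point (X : psset) m n (theta : dmap m n) :
  ss_map X theta point = point.
Proof. exact: pmap_pt. Qed.

Lemma spherical_point (X : psset) n : spherical (point : X n).
Proof. by case: n => //= n; apply/forallP => j; rewrite pmap_pt. Qed.

HB.instance Definition _ (X : psset) n := Choice.on (sph X n).
HB.instance Definition _ (X : psset) n :=
  isPointed.Build (sph X n) (exist _ point (spherical_point X n)).

Definition pi_eqv (X : psset) n : rel (sph X n) :=
  fun x y => `[< clos_refl_sym_trans _ (@piR X n) x y >].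

Lemma pi_eqv_class (X : psset) n : equiv_class_of (@pi_eqv X n).
Proof.
split=> [x|x y|y x z].
- by apply/asboolP; apply: rst_refl.
- by apply/asboolP/asboolP; apply: rst_sym.
- by move=> /asboolP h1 /asboolP h2; apply/asboolP; apply: rst_trans h1 h2.
Qed.

Canonical pi_eqv_equiv (X : psset) n := EquivRelPack (@pi_eqv_class X n).
Canonical pi_eqv_encModRel (X : psset) n := defaultEncModRel (@pi_eqv X n).

Definition pi_quot (X : psset) n := {eq_quot (@pi_eqv X n)}%qT.
HB.instance Definition _ (X : psset) n := EqQuotient.on (pi_quot X n).
HB.instance Definition _ (X : psset) n := Choice.on (pi_quot X n).
HB.instance Definition _ (X : psset) n :=
  isPointed.Build (pi_quot X n) (\pi_(pi_quot X n) point)%qT.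

Lemma spherical_map (X Y : psset) (F : pssmap X Y) n (x : sph X n) :
  spherical (F n (val x)).
Proof.
case: n x => //= n [x /= /forallP sx]; apply/forallP => j.
by rewrite -pss_nat (eqP (sx j)) pmap_pt.
Qed.

Definition sph_fun (X Y : psset) (F : pssmap X Y) n (x : sph X n) : sph Y n :=
  exist _ (F n (val x)) (spherical_map F x).

Definition pi_fun (X Y : psset) (F : pssmap X Y) n (c : pi_quot X n) : pi_quot Y n :=
  (\pi_(pi_quot Y n) (sph_fun F (repr c)))%qT.

Lemma piR_map (X Y : psset) (F : pssmap X Y) n (x y : sph X n) :
  piR x y -> piR (sph_fun F x) (sph_fun F y).
Proof.
case=> z [z0 zx zy]; exists (F n.+1 z); split.
- by move=> j jn; rewrite -pss_nat z0 // pmap_pt.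
- by rewrite /= -zx pss_nat.
- by rewrite /= -zy pss_nat.
Qed.

Lemma pi_fun_pi (X Y : psset) (F : pssmap X Y) n (x : sph X n) :
  pi_fun F (\pi_(pi_quot X n) x)%qT = (\pi_(pi_quot Y n) (sph_fun F x))%qT.
Proof.
apply/eqmodP/asboolP.
have /eqmodP/asboolP : (repr (\pi_(pi_quot X n) x) = x %[mod (pi_quot X n)])%qT.
  by rewrite reprK.
move: (repr _) => y; elim=> [a b ab|a|a b _|a b c _ ab _ bc].
- exact/rst_step/piR_map.
- exact: rst_refl.
- exact: rst_sym.
- exact: rst_trans ab bc.
Qed.

Lemma pi_fun_pt (X Y : psset) (F : pssmap X Y) n :
  pi_fun F (point : pi_quot X n) = point.
Proof.
rewrite /point /= pi_fun_pi; congr (\pi_(_) _)%qT.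
by apply: val_inj; rewrite /= pmap_pt.
Qed.

Definition pi_map (X Y : psset) (F : pssmap X Y) n : pmap (pi_quot X n) (pi_quot Y n) :=
  Pmap (pi_fun_pt F n).

Section PiModule.
Variables (n : nat) (G : gspace).

Lemma pi_gs_id k (c : pi_quot (G k) n) : pi_map (gs_map G (pid (kplus k))) n c = c.
Proof.
rewrite -[c in LHS]reprK /= pi_fun_pi -[RHS]reprK; congr (\pi_(_) _)%qT.
by apply: val_inj; rewrite /= gs_id.
Qed.

Lemma pi_gs_comp k l m (g : pmap (kplus l) (kplus m))
    (f : pmap (kplus k) (kplus l)) (c : pi_quot (G k) n) :
  pi_map (gs_map G (pcomp g f)) n c =
  pi_map (gs_map G g) n (pi_map (gs_map G f) n c).
Proof.
rewrite -[c]reprK /= (pi_fun_pi (gs_map G f)).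
rewrite (pi_fun_pi (gs_map G g)) (pi_fun_pi (gs_map G _)).
congr (\pi_(_) _)%qT.
by apply: val_inj; rewrite /= gs_comp.
Qed.

Lemma pi_gs_pointed (c : pi_quot (G 0) n) : c = point.
Proof.
rewrite -[c]reprK; congr (\pi_(_) _)%qT.
by apply: val_inj; apply: gs_pointed.
Qed.

Definition pi_smodule : smodule :=
  @Smodule (fun k => pi_quot (G k) n) (fun k l f => pi_map (gs_map G f) n)
    pi_gs_id pi_gs_comp pi_gs_pointed.

End PiModule.

End Homotopy.

Section Smash.

Definition smash (X Z : finPointedType) := option (nonbase X * nonbase Z).
HB.instance Definition _ X Z := Finite.on (smash X Z).
HB.instance Definition _ X Z := isPointed.Build (smash X Z) None.

Definition smash_pair (X Z : finPointedType) (x : X) (z : Z) : smash X Z :=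
  if (insub x : option (nonbase X), insub z : option (nonbase Z))
    is (Some x', Some z') then Some (x', z') else None.

Definition smash_fun (X X' Z Z' : finPointedType) (f : X -> X') (g : Z -> Z')
    (s : smash X Z) : smash X' Z' :=
  if s is Some (x, z) then smash_pair (f (val x)) (g (val z)) else None.

Lemma smash_pair0l (X Z : finPointedType) (z : Z) :
  smash_pair (point : X) z = None.
Proof. by rewrite /smash_pair insubF ?eqxx. Qed.

Lemma smash_pair0r (X Z : finPointedType) (x : X) :
  smash_pair x (point : Z) = None.
Proof. by rewrite /smash_pair; case: insub => //= ?; rewrite insubF ?eqxx. Qed.

Lemma smash_fun_pair (X X' Z Z' : finPointedType) (f : pmap X X')
    (g : pmap Z Z') (x : X) (z : Z) :
  smash_fun f g (smash_pair x z) = smash_pair (f x) (g z).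
Proof.
case: (eqVneq x point) => [->|nx]; first by rewrite pmap_pt !smash_pair0l.
case: (eqVneq z point) => [->|nz]; first by rewrite pmap_pt !smash_pair0r.
by rewrite {1}/smash_pair !insubT.
Qed.

End Smash.

Record fpair := FPair {
  fp_set :> finPointedType;
  fp_sub : {set fp_set};
  fp_pt : point \in fp_sub }.

Record fpmap (P P' : fpair) := FPMap {
  fpm_fun :> pmap P P';
  fpm_sub : forall x, x \in fp_sub P -> fpm_fun x \in fp_sub P' }.

Section PairSmash.

Lemma pair_smash_pt (P : fpair) (Z : finPointedType) :
  point \in [set smash_pair y z | y in fp_sub P, z in [set: Z]].
Proof.
apply/imset2P; exists point point; rewrite ?inE ?fp_pt //.
by rewrite smash_pair0l.
Qed.

Definition pair_smash (P : fpair) (Z : finPointedType) : fpair :=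
  FPair (pair_smash_pt P Z).

Lemma pair_smash_map_sub (P P' : fpair) (Z Z' : finPointedType)
    (f : fpmap P P') (g : pmap Z Z') x :
  x \in fp_sub (pair_smash P Z) ->
  smash_fun f g x \in fp_sub (pair_smash P' Z').
Proof.
move=> /imset2P[y z yP _ ->]; rewrite smash_fun_pair.
by apply: imset2_f; rewrite ?inE ?fpm_sub.
Qed.

Definition pair_smash_map (P P' : fpair) (Z Z' : finPointedType)
    (f : fpmap P P') (g : pmap Z Z') :
    fpmap (pair_smash P Z) (pair_smash P' Z') :=
  @FPMap (pair_smash P Z) (pair_smash P' Z')
    (@Pmap (smash P Z) (smash P' Z') (smash_fun f g) erefl)
    (@pair_smash_map_sub P P' Z Z' f g).

End PairSmash.

Section KFunctor.
Variables (R : realType) (L : zmodClosed R) (lambda : {nonneg R}).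

Local Notation RL := {ideal_quot L}.

(* An element psi of K_{L,lambda}(X, Y) is stored as the pair of its          *)
(* R-valued part on X \ Y and its R/L-valued part on Y \ {*}.                 *)
Definition offY (P : fpair) := {x : P | x \notin fp_sub P}.
Definition onY (P : fpair) := {y : P | (y \in fp_sub P) && (y != point)}.

Definition Kpre (P : fpair) := ({ffun offY P -> R} * {ffun onY P -> RL})%type.

Definition Kle (P : fpair) (psi : Kpre P) : bool :=
  \sum_x `|psi.1 x| <= lambda%:num.

Definition K (P : fpair) := {psi : Kpre P | Kle psi}.

Lemma Kle0 (P : fpair) : Kle ((0, 0) : Kpre P).
Proof. by rewrite /Kle big1 // => x _; rewrite ffunE normr0. Qed.

HB.instance Definition _ P := Choice.on (K P).
HB.instance Definition _ P := isPointed.Build (K P) (exist _ ((0, 0) : Kpre P) (Kle0 P)).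

Definition K_funR (P P' : fpair) (f : fpmap P P') (psi : Kpre P) :
    {ffun offY P' -> R} :=
  [ffun y => \sum_(x : offY P | f (val x) == val y) psi.1 x].

Definition K_funQ (P P' : fpair) (f : fpmap P P') (psi : Kpre P) :
    {ffun onY P' -> RL} :=
  [ffun y => \sum_(x : offY P | f (val x) == val y) (\pi_RL (psi.1 x))%qT
           + \sum_(x : onY P | f (val x) == val y) psi.2 x].

Definition K_pre (P P' : fpair) (f : fpmap P P') (psi : Kpre P) : Kpre P' :=
  (K_funR f psi, K_funQ f psi).

Lemma Kle_map (P P' : fpair) (f : fpmap P P') (psi : K P) :
  Kle (K_pre f (val psi)).
Proof.
apply: le_trans (valP psi); rewrite /Kle /=.
under eq_bigr do rewrite ffunE.
exact: (fiber_norm _ (fun x : offY P => f (val x))).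
Qed.

Definition K_fun (P P' : fpair) (f : fpmap P P') (psi : K P) : K P' :=
  exist _ (K_pre f (val psi)) (Kle_map f psi).

Lemma piL0 : (\pi_RL 0)%qT = 0 :> RL.
Proof. by apply/esym; rewrite /GRing.zero /= /Quotient.zero; unlock. Qed.

Lemma piLD (x y : R) : (\pi_RL (x + y) = \pi_RL x + \pi_RL y :> RL)%qT.
Proof. by rewrite piE. Qed.

Lemma piL_sum (I : finType) (P : pred I) (F : I -> R) :
  (\pi_RL (\sum_(i | P i) F i) = \sum_(i | P i) \pi_RL (F i) :> RL)%qT.
Proof. by apply: (big_morph _ piLD piL0). Qed.

Lemma K_fun_pt (P P' : fpair) (f : fpmap P P') : K_fun f point = point.
Proof.
apply: val_inj; congr pair; apply/ffunP => y; rewrite !ffunE.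
  by rewrite big1 // => x _; rewrite ffunE.
by rewrite !big1 ?addr0 // => x _; rewrite ffunE ?piL0.
Qed.

Definition K_map (P P' : fpair) (f : fpmap P P') : pmap (K P) (K P') :=
  Pmap (K_fun_pt f).

Lemma K_map_ext (P P' : fpair) (f g : fpmap P P') (psi : K P) :
  f =1 g -> K_map f psi = K_map g psi.
Proof.
move=> fg; apply: val_inj; congr pair; apply/ffunP => y; rewrite !ffunE.
  by apply: eq_bigl => x; rewrite fg.
by congr (_ + _); apply: eq_bigl => x; rewrite fg.
Qed.

Lemma K_map_id (P : fpair) (f : fpmap P P) (psi : K P) :
  f =1 id -> K_map f psi = psi.
Proof.
move=> fid; apply: val_inj; rewrite /= [RHS]surjective_pairing; congr pair.
  apply/ffunP => y; rewrite ffunE (big_pred1 y) // => x /=; by rewrite fid.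
apply/ffunP => y; rewrite ffunE big_pred0 => [|x].
  rewrite add0r (big_pred1 y) // => x /=; by rewrite fid.
rewrite fid; apply/negbTE; apply: contraNneq (valP x) => ->.
by case/andP: (valP y).
Qed.

Lemma K_map_comp (P P' P'' : fpair) (g : fpmap P' P'') (f : fpmap P P')
    (h : fpmap P P'') (psi : K P) :
  h =1 g \o f -> K_map h psi = K_map g (K_map f psi).
Proof.
move=> hgf; apply: val_inj; congr pair; apply/ffunP => y; rewrite !ffunE.
  under [RHS]eq_bigr do rewrite ffunE.
  rewrite (fiber_sum _ (fun z => g z == val y) (fun x : offY P => f (val x))).
  apply: eq_bigl => x /=; rewrite hgf /=.
  case: eqVneq => [gf|]; last by rewrite andbF.
  rewrite andbT; apply/esym; apply: contra (valP y) => /(fpm_sub g).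
  by rewrite gf.
have [yY y0] := andP (valP y).
under [X in _ = X + _]eq_bigr do rewrite ffunE piL_sum.
under [X in _ = _ + X]eq_bigr do rewrite ffunE.
rewrite big_split /= !(fiber_sum _ (fun z => g z == val y)).
have gn0 (x : P) : g (f x) = val y -> f x != point.
  by move=> gf; apply: contraNneq y0 => fx; rewrite -gf fx pmap_pt.
rewrite addrA; congr (_ + _).
  rewrite [LHS](bigID (fun x => f (val x) \notin fp_sub P')) /=.
  congr (_ + _); apply: eq_bigl => x; rewrite hgf /= andbC //.
  rewrite negbK; case: eqVneq => [gf|]; last by rewrite !andbF.
  by rewrite gn0 // !andbT.
apply: eq_bigl => x; rewrite hgf /=; case: eqVneq => [gf|]; last by rewrite andbF.
have [xY _] := andP (valP x).
by rewrite gn0 // fpm_sub.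
Qed.

End KFunctor.

Section Intervals.

(* [n]^* = 'I_n.+2; as theta is nondecreasing, theta^*(j), the least i with   *)
(* j <= theta i (or m.+1 if there is none), is the number of i with           *)
(* theta i < j.                                                               *)
Definition dual m n (theta : dmap m n) (j : 'I_n.+2) : 'I_m.+2 :=
  inord #|[set i | (theta i < j)%N]|.

Lemma val_dual m n (theta : dmap m n) (j : 'I_n.+2) :
  dual theta j = #|[set i | (theta i < j)%N]| :> nat.
Proof.
by rewrite inordK // ltnS -[X in (_ <= X)%N]card_ord max_card.
Qed.

Lemma dualP m n (theta : dmap m n) (j : 'I_n.+2) (i : 'I_m.+1) :
  (j <= theta i)%N = (dual theta j <= i)%N.
Proof.
have homo (a b : 'I_m.+1) : (a <= b)%N -> (theta a <= theta b)%N.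
  by move=> ab; have := @omorph_le _ _ _ _ theta a b; rewrite !leEord; apply.
have cardlt (c : nat) : (c <= m.+1)%N -> #|[set k : 'I_m.+1 | (k < c)%N]| = c.
  move=> cm; have inj : injective (widen_ord cm).
    by move=> a b /(congr1 val) /= /val_inj.
  rewrite -[RHS]card_ord -(card_imset _ inj).
  apply: eq_card => k; rewrite inE; apply/idP/imsetP => [kc|[l _ ->]//=].
  by exists (Ordinal kc) => //; apply: val_inj.
rewrite val_dual; apply/idP/idP => [ji|].
  rewrite -(cardlt i) ?(ltnW (ltn_ord i)) //; apply: subset_leq_card.
  apply/fintype.subsetP => k; rewrite !inE => kj; rewrite ltnNge; apply: contraTN kj.
  by move=> /homo ik; rewrite -leqNgt (leq_trans ji).
apply: contraTT; rewrite -!ltnNge => ij.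
rewrite -[X in (X <= _)%N](cardlt i.+1) ?ltn_ord //; apply: subset_leq_card.
apply/fintype.subsetP => k; rewrite !inE ltnS => /homo ki; exact: leq_ltn_trans ki ij.
Qed.

Lemma itv_eq m (x y : 'I_m.+2) :
  (forall i : 'I_m.+1, (x <= i)%N = (y <= i)%N) -> x = y.
Proof.
move=> xy; apply/val_inj/eqP; rewrite eqn_leq; apply/andP; split.
  case: (ltnP y m.+1) => [ym|my]; first by rewrite (xy (Ordinal ym)) /=.
  by apply: leq_trans my; rewrite -ltnS ltn_ord.
case: (ltnP x m.+1) => [xm|mx]; first by rewrite -(xy (Ordinal xm)) /=.
by apply: leq_trans mx; rewrite -ltnS ltn_ord.
Qed.

Lemma dual_id n (j : 'I_n.+2) : dual (idfun : dmap n n) j = j.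
Proof. by apply: itv_eq => i; rewrite -dualP. Qed.

Lemma dual_comp m n p (theta : dmap n p) (eta : dmap m n) (j : 'I_p.+2) :
  dual (theta \o eta : dmap m p) j = dual eta (dual theta j).
Proof. by apply: itv_eq => i; rewrite -!dualP. Qed.

Lemma dual_homo m n (theta : dmap m n) (j j' : 'I_n.+2) :
  (j <= j')%N -> (dual theta j <= dual theta j')%N.
Proof.
move=> jj; rewrite !val_dual; apply: subset_leq_card.
by apply/fintype.subsetP => i; rewrite !inE => /leq_trans; apply.
Qed.

Lemma dual0 m n (theta : dmap m n) : dual theta ord0 = ord0.
Proof. by apply: itv_eq => i; rewrite -dualP. Qed.

Lemma dual_max m n (theta : dmap m n) : dual theta ord_max = ord_max.
Proof.
by apply: itv_eq => i; rewrite -dualP /= [LHS]leqNgt [RHS]leqNgt !ltn_ord.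
Qed.

Lemma simplex_pair_pt n : (point : 'I_n.+2) \in [set ord0; ord_max].
Proof. by rewrite !inE eqxx. Qed.

(* The pair ([n]^*, {0, n+1}).                                                *)
Definition simplex_pair (n : nat) : fpair :=
  @FPair 'I_n.+2 [set ord0; ord_max] (simplex_pair_pt n).

Lemma simplex_pair_sub m n (theta : dmap m n) (x : 'I_n.+2) :
  x \in [set ord0; ord_max] -> dual theta x \in [set ord0; ord_max].
Proof.
by rewrite !inE => /orP[]/eqP->; rewrite ?dual0 ?dual_max eqxx ?orbT.
Qed.

Definition simplex_map m n (theta : dmap m n) :
    fpmap (simplex_pair n) (simplex_pair m) :=
  @FPMap (simplex_pair n) (simplex_pair m)
    (@Pmap 'I_n.+2 'I_m.+2 (dual theta) (dual0 theta))
    (@simplex_pair_sub m n theta).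

End Intervals.

Section HDspace.
Variables (R : realType) (L : zmodClosed R) (lambda : {nonneg R}).

Definition HK_pair (k n : nat) : fpair := pair_smash (simplex_pair n) (kplus k).

Definition HK_pair_map k l m n (f : pmap (kplus k) (kplus l))
    (theta : dmap m n) : fpmap (HK_pair k n) (HK_pair l m) :=
  pair_smash_map (simplex_map theta) f.

Lemma smash_some (X Z : finPointedType) (x : nonbase X) (z : nonbase Z) :
  smash_pair (val x) (val z) = Some (x, z).
Proof. by rewrite /smash_pair !valK. Qed.

Lemma HK_pair_map_id k n :
  HK_pair_map (pid (kplus k)) (idfun : dmap n n) =1 id.
Proof. by case=> [[x z]|] //=; rewrite dual_id smash_some. Qed.

Lemma HK_pair_map_comp k l m n p q (g : pmap (kplus l) (kplus m))
    (f : pmap (kplus k) (kplus l)) (theta : dmap p q) (eta : dmap n p) :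
  HK_pair_map (pcomp g f) (theta \o eta : dmap n q) =1
  HK_pair_map g eta \o HK_pair_map f theta.
Proof.
case=> [[x z]|] //=.
rewrite -[dual theta (val x)]/(simplex_map theta (val x)).
by rewrite (smash_fun_pair (simplex_map eta) g) /= dual_comp.
Qed.

Lemma HK_ss_id k n (x : K L lambda (HK_pair k n)) :
  K_map L lambda (HK_pair_map (pid (kplus k)) (idfun : dmap n n)) x = x.
Proof. by apply: K_map_id; apply: HK_pair_map_id. Qed.

Lemma HK_ss_comp k m n p (theta : dmap n p) (eta : dmap m n)
    (x : K L lambda (HK_pair k p)) :
  K_map L lambda (HK_pair_map (pid (kplus k)) (theta \o eta : dmap m p)) x =
  K_map L lambda (HK_pair_map (pid (kplus k)) eta)
    (K_map L lambda (HK_pair_map (pid (kplus k)) theta) x).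
Proof.
by apply: K_map_comp => s; rewrite -[in RHS]HK_pair_map_comp.
Qed.

Definition HK_psset (k : nat) : psset :=
  @PSSet (fun n => K L lambda (HK_pair k n))
    (fun m n theta => K_map L lambda (HK_pair_map (pid (kplus k)) theta))
    (@HK_ss_id k) (@HK_ss_comp k).

Definition HK_gs_fun k l (f : pmap (kplus k) (kplus l)) (n : nat) :
    pmap (HK_psset k n) (HK_psset l n) :=
  K_map L lambda (HK_pair_map f (idfun : dmap n n)).

Lemma HK_gs_nat k l (f : pmap (kplus k) (kplus l)) m n (theta : dmap m n)
    (x : HK_psset k n) :
  HK_gs_fun f m (ss_map (HK_psset k) theta x) =
  ss_map (HK_psset l) theta (HK_gs_fun f n x).
Proof.
have e (P : fpmap (HK_pair k n) (HK_pair l m)) :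
    P =1 HK_pair_map f theta ->
  K_map L lambda P x = K_map L lambda (HK_pair_map f theta) x.
  by move=> h; apply: K_map_ext.
transitivity (K_map L lambda (HK_pair_map f theta) x).
  symmetry; apply: K_map_comp => s.
  by rewrite -HK_pair_map_comp; case: s => [[u v]|].
apply: K_map_comp => s.
by rewrite -HK_pair_map_comp; case: s => [[u v]|].
Qed.

Definition HK_gs_map k l (f : pmap (kplus k) (kplus l)) :
    pssmap (HK_psset k) (HK_psset l) :=
  @PSSMap (HK_psset k) (HK_psset l) (HK_gs_fun f) (HK_gs_nat f).

Lemma HK_gs_id k n (x : HK_psset k n) : HK_gs_map (pid (kplus k)) n x = x.
Proof. exact: HK_ss_id. Qed.

Lemma HK_gs_comp k l m (g : pmap (kplus l) (kplus m))
    (f : pmap (kplus k) (kplus l)) n (x : HK_psset k n) :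
  HK_gs_map (pcomp g f) n x = HK_gs_map g n (HK_gs_map f n x).
Proof.
apply: K_map_comp => s.
by rewrite -HK_pair_map_comp; case: s => [[u v]|].
Qed.

Lemma HK_gs_pointed n (x : HK_psset 0 n) : x = point.
Proof.
have s0 (s : HK_pair 0 n) : s = point.
  by case: s => // -[u v]; case: (nonbase0 v).
apply: val_inj; rewrite /= [LHS]surjective_pairing; congr pair.
  by apply/ffunP => y; case/negP: (valP y); rewrite (s0 (val y)) fp_pt.
by apply/ffunP => y; case/andP: (valP y); rewrite (s0 (val y)) eqxx.
Qed.

Definition HK : gspace :=
  @GSpace HK_psset HK_gs_map HK_gs_id HK_gs_comp HK_gs_pointed.

End HDspace.

Section PadicAbs.

Definition padic_abs (p : nat) (q : rat) : rat :=
  if q == 0 then 0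
  else p%:R ^ ((logn p `|denq q|)%:Z - (logn p `|numq q|)%:Z).

Lemma padic_abs_frac p (n d : int) : n != 0 -> d != 0 ->
  padic_abs p (n%:Q / d%:Q) = p%:R ^ ((logn p `|d|)%:Z - (logn p `|n|)%:Z).
Proof.
move=> n0 d0; set q := n%:Q / d%:Q.
have q0 : q != 0 by rewrite mulf_neq0 ?invr_eq0 ?intr_eq0.
rewrite /padic_abs (negbTE q0); congr (_ ^ _).
have e : n * denq q = numq q * d.
  apply/eqP; rewrite -(eqr_int rat) !rmorphM /= numqE.
  by rewrite [q * _]mulrC -mulrA divfK ?intr_eq0 // mulrC.
have := congr1 (logn p \o absz) e; rewrite /= !abszM.
rewrite !lognM ?absz_gt0 ?denq_eq0 ?numq_eq0 // => /(congr1 Posz).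
rewrite !PoszD => h; apply/eqP; rewrite subr_eq addrAC eq_sym subr_eq.
by rewrite addrC -h addrC.
Qed.

(* The ultrametric inequality, in the form needed here.                       *)
Lemma padic_abs_le_sub p (a : int) (x y : rat) : prime p ->
  padic_abs p x <= p%:R ^ a -> padic_abs p y <= p%:R ^ a ->
  padic_abs p (x - y) <= p%:R ^ a.
Proof.
move=> pp.
have p1 : 1 < p%:R :> rat by rewrite ltr1n prime_gt1.
have pos : 0 < p%:R ^ a :> rat by rewrite exprz_gt0 // (lt_trans ltr01 p1).
have [->|x0] := eqVneq x 0.
  move=> _; rewrite sub0r.
  suff -> : padic_abs p (- y) = padic_abs p y by [].
  by rewrite /padic_abs oppr_eq0 numqN denqN abszN.
have [->|y0] := eqVneq y 0; first by rewrite subr0.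
have [->|xy0] := eqVneq (x - y) 0; first by move=> _ _; rewrite /padic_abs eqxx ltW.
rewrite [padic_abs p x]/padic_abs [padic_abs p y]/padic_abs.
rewrite (negbTE x0) (negbTE y0) !ler_eXz2l // => hx hy.
set dx := denq x; set dy := denq y.
have dx0 : dx != 0 by rewrite denq_eq0.
have dy0 : dy != 0 by rewrite denq_eq0.
pose n := numq x * dy - numq y * dx.
have e : x - y = n%:Q / (dx * dy)%:Q.
  rewrite -[x in LHS]divq_num_den -[y in LHS]divq_num_den.
  rewrite -mulNr addf_div ?intr_eq0 // rmorphM /= rmorphB /= !rmorphM /=.
  by rewrite mulNr.
have n0 : n != 0.
  by apply: contraNneq xy0 => n0; rewrite e n0 mul0r.
rewrite e padic_abs_frac ?mulf_neq0 // ler_eXz2l //.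
rewrite abszM lognM ?absz_gt0 // PoszD.
pose m := minn (logn p `|numq x| + logn p `|dy|) (logn p `|numq y| + logn p `|dx|).
have mn : (m <= logn p `|n|)%N.
  rewrite -pfactor_dvdn ?absz_gt0 //.
  have dz : ((p ^ m)%:Z %| n)%Z.
    apply: rpredB; rewrite dvdzE /= abszM pfactor_dvdn ?muln_gt0 ?absz_gt0 //;
    rewrite ?numq_eq0 ?x0 ?y0 ?dx0 ?dy0 // lognM ?absz_gt0 ?numq_eq0 //;
    by rewrite ?geq_minl ?geq_minr.
  by rewrite dvdzE in dz.
move: hx hy mn; rewrite -/dx -/dy /m; lia.
Qed.

End PadicAbs.

Record arakelov_divisor (R : realType) := ArakelovDivisor {
  ar_fin : {fsfun nat -> int with 0};
  ar_fin_prime : forall p, p \in finsupp ar_fin -> prime p;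
  ar_inf : R }.

Section Arakelov.
Variables (R : realType) (D : arakelov_divisor R).

Definition ar_deg : R :=
  \sum_(p <- finsupp (ar_fin D)) (ar_fin D p)%:~R * ln p%:R + ar_inf D.

(* H^0(Spec Z, O(D_finite)), embedded in R.                                   *)
Definition H0 : {pred R} := fun x =>
  `[< exists2 q : rat,
        forall p, prime p -> padic_abs p q <= p%:R ^ ar_fin D p
        & x = ratr q >].

Lemma H0_zmod_closed : zmod_closed H0.
Proof.
split=> [|x y].
  apply/asboolP; exists 0; last by rewrite rmorph0.
  by move=> p pp; rewrite /padic_abs eqxx exprz_ge0.
move=> /asboolP[q hq ->] /asboolP[r hr ->]; apply/asboolP.
exists (q - r); last by rewrite rmorphB.
by move=> p pp; apply: padic_abs_le_sub; [|apply: hq|apply: hr].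
Qed.

HB.instance Definition _ := GRing.isZmodClosed.Build R H0 H0_zmod_closed.

Definition HD : gspace := HK H0 (expR (ar_inf D))%:nng.

End Arakelov.

Section Gamma.
Variable R : realType.

Definition intR : {pred R} := fun x => x \is a Num.int.

Lemma intR_zmod_closed : zmod_closed intR.
Proof. by split=> [|x y]; [apply: rpred0|apply: rpredB]. Qed.

HB.instance Definition _ := GRing.isZmodClosed.Build R intR intR_zmod_closed.

Definition gamma (n k : nat) : nat :=
  #|` fset_set [set: normHA_smodule intR (n%:R)%:nng k]|.

End Gamma.

(* Main.v *)
Require Import Defs.
From Stdlib Require Import Relations.
From mathcomp Require Import all_boot all_order all_algebra finmap.
From mathcomp Require Import mathcomp_extra boolp classical_sets functions.
From mathcomp Require Import cardinality reals interval_inference sequences exp.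
From mathcomp Require Import zify ring lra.

Set Implicit Arguments.
Unset Strict Implicit.
Unset Printing Implicit Defensive.

Import Order.TTheory GRing.Theory Num.Theory.
Local Open Scope classical_set_scope.
Local Open Scope card_scope.
Local Open Scope ring_scope.

(** An n-simplex of H(D)(k_+) is a list (v_1, ..., v_n; c) of n real vectors of
    length k, of total l1-norm at most lambda = e^a, followed by a vector c over
    R/L. The face d_0 drops v_1, an inner face adds two neighbouring v_i, and
    the last face adds the class of v_n to c ([rcoord_face], [qcoord_face]).
    Everything about homotopy is read off these formulas, for any subgroup L.

    - Above degree 1 a spherical simplex is the base point, since d_0 and the
      last face between them detect all coordinates ([spherical_ge2]).
    - A spherical 1-simplex (v; c) has c = 0 and v in L^k ([spherical1P]), and
      related spherical 1-simplices are equal ([piR1E]); so pi_1 is the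
      lambda-ball of L^k, naturally in k ([pi1_iso]).
    - Two 0-simplices are related when they differ by the class of a vector of
      norm at most lambda, so pi_0 is trivial when lambda-balls around L^k cover
      R^k ([pi0_trivialP]).

    For the Arakelov divisor D, checking absolute values prime by prime shows
    that L = gZ for g the product of the p^(-a_p) ([mem_H0]), and
    lambda / g = e^(deg D) ([expR_ar_deg]). The covering radius of (gZ)^k for
      the
    l1-norm is k g / 2 ([covering_radius]), which gives the criterion for pi_0;
    dividing by g identifies the lambda-ball of L^k with the integral vectors of
    norm at most the integral part of e^(deg D), which gives the cardinality of
    pi_1 ([normHA_card]). *)

(** * Coordinates of the simplices *)

Lemma inj_surj_bijective (X Y : Type) (f : X -> Y) :
  injective f -> (forall y, exists x, f x = y) -> bijective f.
Proof.
move=> inj surj; exists (fun y => projT1 (cid (surj y))) => [x|y];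
  case: cid => //.
by move=> ? /= /inj.
Qed.

Lemma smash_pair_eqE (X Z : finPointedType) (a : X) (b : Z) (u : nonbase X)
    (v : nonbase Z) :
  (smash_pair a b == Some (u, v)) = (a == val u) && (b == val v).
Proof.
rewrite /smash_pair; case: insubP => [a' _ <-|na]; last first.
  by move/negPn/eqP: na => ->; rewrite [point == val u]eq_sym (negbTE (valP u)).
case: insubP => [b' _ <-|nb]; first by rewrite !val_eqE.
by move/negPn/eqP: nb => ->;
  rewrite [point == val v]eq_sym (negbTE (valP v)) andbF.
Qed.

Section Coordinates.
Variables (R : realType) (L : zmodClosed R) (lambda : {nonneg R}).

(** Real vectors are indexed from 0, so the one of index i sits at i.+1 in
    [n]^*. *)
Definition inner n (i : 'I_n) : 'I_n.+2 :=
  widen_ord (leqnSn n.+1) (lift ord0 i).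

Lemma inner_n0 n (i : 'I_n) : inner i != point.
Proof. by []. Qed.

Lemma outer_n0 n : ord_max != point :> 'I_n.+2.
Proof. by []. Qed.

Definition nb_inner n (i : 'I_n) : nonbase 'I_n.+2 :=
  exist (fun a : 'I_n.+2 => is_true (a != point)) (inner i) (inner_n0 i).
Definition nb_outer n : nonbase 'I_n.+2 :=
  exist (fun a : 'I_n.+2 => is_true (a != point)) ord_max (outer_n0 n).

Lemma mem_HK_sub k n (u : nonbase 'I_n.+2) (z : nonbase (kplus k)) :
  (Some (u, z) \in fp_sub (HK_pair k n)) = (val u == ord_max).
Proof.
apply/imset2P/eqP => [[a b]|e].
  rewrite !inE => /orP[]/eqP-> _; first by rewrite smash_pair0l.
  by move/esym/eqP; rewrite smash_pair_eqE => /andP[/eqP<-].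
exists ord_max (val z); rewrite ?inE ?eqxx ?orbT //.
by apply/esym/eqP; rewrite smash_pair_eqE e !eqxx.
Qed.

Lemma nonbase_innerP n (u : nonbase 'I_n.+2) : val u != ord_max ->
  {i : 'I_n | u = nb_inner i}.
Proof.
case: u => -[u un] /= u0; rewrite -val_eqE /= => umax.
have ui : (u.-1 < n)%N.
  by move: u0; rewrite -val_eqE /= ; lia.
exists (Ordinal ui); apply/val_inj/val_inj => /=.
by move: u0; rewrite -val_eqE /bump /=; lia.
Qed.

Lemma inner_pt_subproof k n (p : 'I_n * nonbase (kplus k)) :
  Some (nb_inner p.1, p.2) \notin fp_sub (HK_pair k n).
Proof.
by rewrite mem_HK_sub -val_eqE /= /bump /= add1n eqSS ltn_eqF.
Qed.

(** The points of [n]^* smash k_+ carrying a real value: the bijectivity proved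
    below turns an n-simplex into n real vectors of length k followed by one
    vector over R/L. *)
Definition inner_pt k n p : offY (HK_pair k n) :=
  exist _ (Some (nb_inner p.1, p.2) : HK_pair k n) (@inner_pt_subproof k n p).

Lemma outer_pt_subproof k n (z : nonbase (kplus k)) :
  ((Some (nb_outer n, z) : HK_pair k n) \in fp_sub (HK_pair k n)) &&
  ((Some (nb_outer n, z) : HK_pair k n) != point).
Proof. by rewrite mem_HK_sub eqxx. Qed.

Definition outer_pt k n z : onY (HK_pair k n) :=
  exist _ (Some (nb_outer n, z) : HK_pair k n) (@outer_pt_subproof k n z).

Lemma inner_pt_bij k n : bijective (@inner_pt k n).
Proof.
have inj : injective (@inner_pt k n).
  move=> [i z] [i' z'] /(congr1 val) /= [/val_inj ii ->].
  by congr pair.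
have surj (y : offY (HK_pair k n)) : exists p, inner_pt p = y.
  case: y => -[[u z]|] yP; last by case/negP: (yP);
    apply: (fp_pt (HK_pair k n)).
  have := yP; rewrite mem_HK_sub => /nonbase_innerP[i e]; exists (i, z).
  by apply: val_inj; rewrite /= e.
exact: inj_surj_bijective inj surj.
Qed.

Lemma outer_pt_bij k n : bijective (@outer_pt k n).
Proof.
have inj : injective (@outer_pt k n) by move=> z z' /(congr1 val) /= [->].
have surj (y : onY (HK_pair k n)) : exists z, outer_pt n z = y.
  case: y => -[[u z]|] yP; last by case/andP: (yP) => _; rewrite eqxx.
  have /andP[] := yP; rewrite mem_HK_sub => /eqP e _; exists z.
  by apply: val_inj; congr (Some (_, _)); apply: val_inj; rewrite e.
exact: inj_surj_bijective inj surj.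
Qed.

Local Notation RL := {ideal_quot L}.
Local Notation simp k n := (K L lambda (HK_pair k n)).

Definition rcoord k n (x : simp k n) (i : 'I_n) (z : nonbase (kplus k)) : R :=
  (val x).1 (inner_pt (i, z)).
Definition qcoord k n (x : simp k n) (z : nonbase (kplus k)) : RL :=
  (val x).2 (outer_pt n z).

Lemma simplex_ext k n (x y : simp k n) :
  (forall i z, rcoord x i z = rcoord y i z) ->
    (forall z, qcoord x z = qcoord y z) -> x = y.
Proof.
move=> hr hq; apply: val_inj;
  rewrite [LHS]surjective_pairing [RHS]surjective_pairing.
have [g _ gK] := inner_pt_bij k n; have [h _ hK] := outer_pt_bij k n.
congr pair; apply/ffunP => s; first by rewrite -(gK s); case: (g s) => i z;
  apply: hr.
by rewrite -(hK s); apply: hq.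
Qed.

Lemma Kle_coord k n (psi : Kpre L (HK_pair k n)) :
  Kle lambda psi = (\sum_i \sum_z `|psi.1 (inner_pt (i, z))| <= lambda%:num).
Proof.
rewrite /Kle (reindex (@inner_pt k n)) /=; last exact/onW_bij/inner_pt_bij.
by rewrite pair_bigA /=; congr (_ <= _); apply: eq_bigr => -[].
Qed.

Lemma rcoord_le k n (x : simp k n) :
  \sum_i \sum_z `|rcoord x i z| <= lambda%:num.
Proof. by rewrite -Kle_coord (valP x). Qed.

(** The predecessor undoes the shift between the index i and the position i.+1
    of an inner point. *)
Definition coords_pre k n (r : 'I_n -> nonbase (kplus k) -> R)
    (q : nonbase (kplus k) -> RL) : Kpre L (HK_pair k n) :=
  (finfun (fun s : offY (HK_pair k n) => if val s is Some (u, z) then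
      oapp (fun i : 'I_n => r i z) 0 (insub (val u).-1) else 0 : R),
   finfun (fun s : onY (HK_pair k n) =>
     if val s is Some (_, z) then q z else 0 : RL)).

(** The source of the explicit simplices below; together with [simplex_ext] it
    lets them be handled through their coordinates alone. *)
Lemma simplex_of_coords k n (r : 'I_n -> nonbase (kplus k) -> R)
    (q : nonbase (kplus k) -> RL) :
  \sum_i \sum_z `|r i z| <= lambda%:num ->
  exists x : simp k n, rcoord x =2 r /\ qcoord x =1 q.
Proof.
have e i z : (coords_pre r q).1 (inner_pt (i, z)) = r i z.
  by rewrite ffunE /= valK.
move=> rl; have kl : Kle lambda (coords_pre r q).
  by rewrite Kle_coord; under eq_bigr do under eq_bigr do rewrite e.
exists (exist (fun p => is_true (Kle lambda p)) _ kl); split; first exact: e.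
by move=> z; rewrite /qcoord ffunE.
Qed.

(** In these coordinates the action of a morphism is a sum over two independent
    fibres, one in [n]^* and one in k_+, because a smash product of maps sends a
    pair to a given non-base pair exactly when both components match. *)
Lemma rcoord_map k l m n (f : Defs.pmap (kplus k) (kplus l)) (theta : dmap m n)
    (x : simp k n) i z :
  rcoord (K_map L lambda (HK_pair_map f theta) x) i z =
  \sum_(i' | dual theta (inner i') == inner i) \sum_(z' | f (val z') == val z)
    rcoord x i' z'.
Proof.
rewrite [LHS]ffunE (reindex (@inner_pt k n)) /=;
  last exact/onW_bij/inner_pt_bij.
rewrite pair_big_dep /=; apply: eq_big => [[i' z']|[]//] /=.
by rewrite smash_pair_eqE.
Qed.

Lemma qcoord_map k l m n (f : Defs.pmap (kplus k) (kplus l)) (theta : dmap m n)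
    (x : simp k n) z :
  qcoord (K_map L lambda (HK_pair_map f theta) x) z =
  (\sum_(i' | dual theta (inner i') == ord_max)
    \sum_(z' | f (val z') == val z) \pi_RL (rcoord x i' z'))%qT
  + \sum_(z' | f (val z') == val z) qcoord x z'.
Proof.
rewrite [LHS]ffunE (reindex (@inner_pt k n)) /=;
  last exact/onW_bij/inner_pt_bij.
rewrite [X in _ + X](reindex (@outer_pt k n)) /=;
  last exact/onW_bij/outer_pt_bij.
rewrite pair_big_dep /=; congr (_ + _).
  by apply: eq_big => [[i' z']|[]//] /=; rewrite smash_pair_eqE.
by apply: eq_bigl => z'; rewrite smash_pair_eqE dual_max eqxx.
Qed.

(** The face d_j merges the points j and j+1 of [n+1]^*. *)
Lemma dual_coface n (j : 'I_n.+2) (a : 'I_n.+3) :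
  dual (coface j) a = (a - (j < a))%N :> nat.
Proof.
have lt : (a - (j < a) < n.+2)%N by have := ltn_ord a; have := ltn_ord j; lia.
rewrite -[RHS]/(val (Ordinal lt)); congr val; apply: itv_eq => i.
by rewrite -dualP /= /bump /=; lia.
Qed.

Lemma sum_pid (V : nmodType) k (z : nonbase (kplus k)) (F :
  nonbase (kplus k) -> V) :
  \sum_(z' | pid (kplus k) (val z') == val z) F z' = F z.
Proof. by rewrite (big_pred1 z) // => z'; rewrite /= val_eqE. Qed.

Lemma rcoord_face k n (j : 'I_n.+2) (x : HK_psset L lambda k n.+1) i z :
  rcoord (face _ j x) i z =
  \sum_(i' : 'I_n.+1 | (i'.+1 - (j < i'.+1))%N == i.+1) rcoord x i' z.
Proof.
rewrite [LHS]rcoord_map; apply: eq_big => i' /=; last by rewrite sum_pid.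
by rewrite -val_eqE /= dual_coface.
Qed.

Lemma qcoord_face k n (j : 'I_n.+2) (x : HK_psset L lambda k n.+1) z :
  qcoord (face _ j x) z =
  (\sum_(i' : 'I_n.+1 | (i'.+1 - (j < i'.+1))%N == n.+1) \pi_RL (rcoord x i'
    z))%qT
  + qcoord x z.
Proof.
rewrite [LHS]qcoord_map sum_pid; congr (_ + _).
apply: eq_big => i' /=; last by rewrite sum_pid.
by rewrite -val_eqE /= dual_coface.
Qed.
End Coordinates.

(** * Homotopy for an arbitrary subgroup of the reals *)

Section Homotopy.
Variables (R : realType) (L : zmodClosed R) (lambda : {nonneg R}).
Local Notation RL := {ideal_quot L}.
Local Notation HK := (HK L lambda).

Lemma piL_eq0 (x : R) : (\pi_RL x == 0)%qT = (x \in L).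
Proof. by rewrite -piL0 -Quotient.idealrBE subr0. Qed.

Lemma piL_eq (x y : R) : (\pi_RL x == \pi_RL y)%qT = (x - y \in L).
Proof. by rewrite -Quotient.idealrBE. Qed.

Lemma rcoord0 k n i z : rcoord (point : HK k n) i z = 0.
Proof. by rewrite [LHS]ffunE. Qed.

Lemma qcoord0 k n z : qcoord (point : HK k n) z = 0.
Proof. by rewrite [LHS]ffunE. Qed.

Lemma rcoord_face_first k n (x : HK k n.+1) i z :
  rcoord (face (HK k) ord0 x) i z = rcoord x (lift ord0 i) z.
Proof.
rewrite rcoord_face (big_pred1 (lift ord0 i)) // => i' /=.
by rewrite -val_eqE /= /bump add1n subn1.
Qed.

Lemma qcoord_face_first k n (x : HK k n.+1) z : qcoord (face (HK k) ord0 x) z =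
  qcoord x z.
Proof.
rewrite qcoord_face big_pred0 ?add0r // => i'.
by rewrite subn1 ltn_eqF ?(ltn_ord i').
Qed.

Lemma rcoord_face_last k n (x : HK k n.+1) i z :
  rcoord (face (HK k) ord_max x) i z = rcoord x (widen_ord (leqnSn n) i) z.
Proof.
rewrite rcoord_face (big_pred1 (widen_ord (leqnSn n) i)) // => i' /=.
by rewrite -val_eqE /= ltnS ltnNge -ltnS ltn_ord subn0.
Qed.

Lemma qcoord_face_last k n (x : HK k n.+1) z :
  qcoord (face (HK k) ord_max x) z =
    (\pi_RL (rcoord x ord_max z))%qT + qcoord x z.
Proof.
rewrite qcoord_face (big_pred1 ord_max) // => i' /=.
by rewrite -val_eqE /= ltnS ltnNge -ltnS ltn_ord subn0.
Qed.

Lemma rcoord_face_mid k (x : HK k 2) z :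
  rcoord (face (HK k) (inord 1) x) ord0 z =
    rcoord x ord0 z + rcoord x ord_max z.
Proof.
rewrite rcoord_face (eq_bigl xpredT) => [|i].
  by rewrite !big_ord_recl big_ord0 addr0; congr (_ + rcoord x _ z);
    apply: val_inj.
by rewrite inordK //; case: i => -[|[|]].
Qed.

Lemma qcoord_face_mid k (x : HK k 2) z : qcoord (face (HK k) (inord 1) x) z =
  qcoord x z.
Proof.
rewrite qcoord_face big_pred0 ?add0r // => i.
by rewrite inordK //; case: i => -[|[|]].
Qed.

Lemma spherical_facesP (X : psset) n (x : X n.+1) :
  reflect (forall j, face X j x = point) (spherical x).
Proof. exact: 'forall_eqP. Qed.

(** From dimension 2 on the first and last faces together see every coordinate:
    the first one sees all but the first real vector, the last one the first
    real vector. *)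
Lemma spherical_ge2 k n (x : sph (HK k) n.+2) : val x = point.
Proof.
move: (val x) (elimT (spherical_facesP (val x)) (valP x)) => {}x sx.
have s0 := sx ord0; have sm := sx ord_max.
apply: simplex_ext => [i z|z];
  last by rewrite qcoord0 -qcoord_face_first s0 qcoord0.
rewrite rcoord0; case: (unliftP ord0 i) => [j ->|->].
  by rewrite -rcoord_face_first s0 rcoord0.
have -> : ord0 = widen_ord (leqnSn n.+1) ord0 by apply: val_inj.
by rewrite -rcoord_face_last sm rcoord0.
Qed.

Lemma pi_ge2_trivial k n : (1 < n)%N -> pi_trivial (HK k) n.
Proof.
case: n => [|[|n]] // _ x y; exists point.
by rewrite !spherical_ge2; split=> *; rewrite pmap_pt.
Qed.

(** A 1-simplex is an element of the lambda-ball of R^k over a vector of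
    (R/L)^k; its faces are that vector and its translate, so a spherical one is
      a
    vector of L^k. *)
Lemma spherical1P k (x : HK k 1) :
  reflect ((forall z, qcoord x z =
    0) /\ forall z, rcoord x ord0 z \in L) (spherical x).
Proof.
have ordM : ord_max = ord0 :> 'I_1 by apply: val_inj.
apply: (iffP (spherical_facesP x)) => [sx|[x0 xL] j].
  have s0 := sx ord0; have sm := sx ord_max.
  have q0 z : qcoord x z = 0 by rewrite -qcoord_face_first s0 qcoord0.
  split=> // z; rewrite -piL_eq0; have := qcoord_face_last x z.
  by rewrite sm qcoord0 q0 addr0 ordM => <-.
apply: simplex_ext => [[]//|z]; rewrite qcoord0.
case: (unliftP ord0 j) => [i ->|->]; last by rewrite qcoord_face_first.
have -> : lift ord0 i = ord_max by apply: val_inj; rewrite (ord1 i).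
by rewrite qcoord_face_last x0 addr0 ordM; apply/eqP; rewrite piL_eq0.
Qed.

(** A 2-simplex (a, b; c) with first face (b; c) trivial has b = 0 and c = 0,
    so its other two faces (a + b; c) and (a; c + b) agree. *)
Lemma piR1E k (x y : sph (HK k) 1) : piR x y <-> x = y.
Proof.
split=> [[w [w0 wx wy]]|->].
  have {}w0 := w0 ord0 isT.
  have w1 z : rcoord w ord_max z = 0.
    have -> : ord_max = lift ord0 ord0 :> 'I_2 by apply: val_inj.
    by rewrite -rcoord_face_first w0 rcoord0.
  have wq z : qcoord w z = 0 by rewrite -qcoord_face_first w0 qcoord0.
  apply: val_inj; apply: simplex_ext => [i z|z].
    rewrite -wx -wy (ord1 i) rcoord_face_mid rcoord_face_last w1 addr0.
    by congr (rcoord w _ z); apply: val_inj.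
  by rewrite -wx -wy qcoord_face_mid qcoord_face_last w1 wq addr0 piL0.
(* Reflexivity is witnessed by (a, 0; 0), where a is the real vector of y. *)
have /spherical1P[q0 _] := valP y.
have rl : \sum_(i : 'I_2) \sum_z
    `|if i == ord0 then rcoord (val y) ord0 z else 0| <= lambda%:num.
  rewrite 2!big_ord_recl big_ord0 /= addr0 [X in _ + X]big1 ?addr0 => [|z _].
    by apply: le_trans (rcoord_le (val y)); rewrite big_ord_recl big_ord0 addr0.
  by rewrite normr0.
have [w [wr wq]] := simplex_of_coords (fun=> 0 : RL) rl.
have q (z : nonbase (kplus k)) : qcoord w z = 0 by rewrite wq.
have w1 z : rcoord w ord_max z = 0 by rewrite wr.
have w0 z : rcoord w ord0 z = rcoord (val y) ord0 z by rewrite wr.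
exists w; split.
- move=> j; rewrite ltnS leqn0 => /eqP j0.
  have -> : j = ord0 by apply: val_inj.
  apply: simplex_ext => [i z|z]; last by rewrite qcoord_face_first q qcoord0.
  rewrite rcoord_face_first rcoord0 -(w1 z); congr (rcoord w _ z).
  by apply: val_inj; rewrite (ord1 i).
- apply: simplex_ext => [i z|z]; last by rewrite qcoord_face_mid q q0.
  by rewrite (ord1 i) rcoord_face_mid w1 addr0.
- apply: simplex_ext => [i z|z].
    by rewrite (ord1 i) rcoord_face_last -w0; congr (rcoord w _ z);
      apply: val_inj.
  by rewrite qcoord_face_last w1 piL0 q q0 addr0.
Qed.

Lemma piR1_equivalence k : equivalence _ (@piR (HK k) 1).
Proof.
split=> [x|x y z|x y]; rewrite ?piR1E //; first by move=> ->.
Qed.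

Lemma pi_eqv1E k (x y : sph (HK k) 1) : pi_eqv x y = (x == y).
Proof.
apply/asboolP/eqP => [|->]; last exact: rst_refl.
by elim=> [? ? /piR1E|//|? ? _ ->|? ? ? _ -> _ ->].
Qed.

(** As the relation is equality, the quotient defining pi_1 identifies
    nothing. *)
Lemma repr_pi1 k (x : sph (HK k) 1) : repr (\pi_(pi_quot (HK k) 1) x)%qT = x.
Proof. by apply/eqP; rewrite -pi_eqv1E -eqmodE reprK. Qed.

Definition lattice_vec k (x : sph (HK k) 1) : HA (subgroup L) k :=
  finfun (fun z => exist (fun a : R => is_true (a \in L)) _
    ((elimT (spherical1P (val x)) (valP x)).2 z)).

Lemma lattice_vec_le k (x : sph (HK k) 1) : norm_le lambda (lattice_vec x).
Proof.
rewrite /norm_le; apply: le_trans (rcoord_le (val x)).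
rewrite big_ord_recl big_ord0 addr0.
by under eq_bigr do rewrite ffunE.
Qed.

Definition sph_to_norm k (x : sph (HK k) 1) : normHA L lambda k :=
  exist (fun phi => is_true (norm_le lambda phi)) _ (lattice_vec_le x).

Lemma sph_to_normE k (x : sph (HK k) 1) z :
  val (val (sph_to_norm x) z) = rcoord (val x) ord0 z.
Proof. by rewrite ffunE. Qed.

Lemma normHA_ext k (phi psi : normHA L lambda k) :
  (forall z, val (val phi z) = val (val psi z)) -> phi = psi.
Proof. by move=> e; apply/val_inj/ffunP => z; apply/val_inj/e. Qed.

Lemma sph_to_norm_bij k : bijective (@sph_to_norm k).
Proof.
have inj : injective (@sph_to_norm k).
  move=> x y xy; apply/val_inj/simplex_ext => [i z|z].
    by rewrite (ord1 i) -!sph_to_normE xy.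
  have /spherical1P[-> _] := valP x.
  by have /spherical1P[-> _] := valP y.
have surj (phi : normHA L lambda k) : exists x, sph_to_norm x = phi.
  have rl : \sum_(i : 'I_1) \sum_z `|val (val phi z)| <= lambda%:num.
    by rewrite big_ord_recl big_ord0 addr0; apply: (valP phi).
  have [x [xr xq]] := simplex_of_coords (fun=> 0 : RL) rl.
  have sx : spherical (x : HK k 1).
    by apply/spherical1P; split=> z; [rewrite xq|rewrite xr; apply: valP].
  exists (exist _ x sx); apply: normHA_ext => z; rewrite sph_to_normE.
  exact: xr.
exact: inj_surj_bijective inj surj.
Qed.

(** The isomorphism reads off the real vector of a spherical 1-simplex. It is
    natural because a map of the k_+ acts on that vector by the fibre sums that
    define HL. *)
Lemma pi1_iso : smodule_iso (pi_smodule 1 HK) (normHA_smodule L lambda).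
Proof.
pose F k (c : pi_quot (HK k) 1) : normHA L lambda k := sph_to_norm (repr c).
have Fpt k : F k point = point.
  apply: normHA_ext => z; rewrite sph_to_normE repr_pi1 rcoord0.
  by rewrite ffunE.
exists (fun k => Pmap (Fpt k)); split=> [k|k l f c].
  have [g gK Kg] := sph_to_norm_bij k.
  exists (fun phi => \pi_(pi_quot (HK k) 1) (g phi))%qT => [c|phi] /=.
    by rewrite /F gK reprK.
  by rewrite /F repr_pi1 Kg.
rewrite -[c]reprK; move: (repr c) => x {c}.
rewrite /= pi_fun_pi /F !repr_pi1; apply: normHA_ext => z.
rewrite sph_to_normE [in RHS]ffunE subgroup_sum.
under [RHS]eq_bigr do rewrite sph_to_normE.
rewrite [LHS]rcoord_map (big_pred1 ord0) // => i.
by rewrite (ord1 i) dual_id eqxx.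
Qed.

(** Two 0-simplices are related when their difference in (R/L)^k lifts to a real
    vector of norm at most lambda. Differences are arbitrary, so triviality of
    pi_0 says that the lambda-balls around L^k cover R^k. *)
Lemma pi0_trivialP k : pi_trivial (HK k) 0 <->
  forall v : nonbase (kplus k) -> R,
    exists2 w, \sum_z `|w z| <= lambda%:num & forall z, v z - w z \in L.
Proof.
have e0 : inord 0 = ord0 :> 'I_2 by apply: val_inj; rewrite /= inordK.
have ordM : ord_max = ord0 :> 'I_1 by apply: val_inj.
split=> [tr v|cov x y].
  have r0 (u : 'I_0 -> nonbase (kplus k) -> R) :
      \sum_i \sum_z `|u i z| <= lambda%:num by rewrite big_ord0.
  have [x [_ xq]] := simplex_of_coords (fun=> 0 : RL) (r0 (fun _ _ => 0)).
  have [y [_ yq]] :=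
    simplex_of_coords (fun z => \pi_RL (v z))%qT (r0 (fun _ _ => 0)).
  have [w [_ wx wy]] := tr (exist _ x isT) (exist _ y isT).
  have {}wx : face (HK k) ord0 w = x by rewrite -e0.
  have {}wy : face (HK k) ord_max w = y by [].
  exists (rcoord w ord0) => [|z].
    by have := rcoord_le w; rewrite big_ord_recl big_ord0 addr0.
  rewrite -piL_eq -yq -wy qcoord_face_last ordM.
  by rewrite -[qcoord w z]qcoord_face_first wx xq addr0.
have [w wl wL] := cov (fun z => repr (qcoord (val y) z - qcoord (val x) z)).
have rl : \sum_(i : 'I_1) \sum_z `|w z| <= lambda%:num.
  by rewrite big_ord_recl big_ord0 addr0.
have [s [sr sq]] := simplex_of_coords (fun z => qcoord (val x) z) rl.
exists s; split=> //.
  by rewrite e0; apply: simplex_ext => [[]//|z]; rewrite qcoord_face_first sq.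
apply: simplex_ext => [[]//|z]; rewrite qcoord_face_last sq sr.
have := wL z; rewrite -piL_eq reprK => /eqP <-.
by rewrite subrK.
Qed.
End Homotopy.

(** * The fractional ideal of an Arakelov divisor *)

Lemma padic_abs0 p : padic_abs p 0 = 0.
Proof. by rewrite /padic_abs eqxx. Qed.

Lemma padic_abs_nat p n : (0 < n)%N ->
  padic_abs p n%:R = p%:R ^ (- (logn p n)%:Z).
Proof.
move=> n0; rewrite -[n%:R]/(n%:Z%:~R) -[_%:~R]divr1 -[1]/(1%:~R).
by rewrite padic_abs_frac //= ?logn1 ?sub0r // eqz_nat -lt0n.
Qed.

Lemma padic_absM p : prime p -> {morph padic_abs p : x y / x * y}.
Proof.
move=> pp x y.
have [->|x0] := eqVneq x 0; first by rewrite mul0r padic_abs0 mul0r.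
have [->|y0] := eqVneq y 0; first by rewrite mulr0 padic_abs0 mulr0.
rewrite -[x]divq_num_den -[y]divq_num_den mulf_div -!rmorphM /=.
rewrite !padic_abs_frac ?mulf_neq0 ?numq_eq0 ?denq_eq0 //.
rewrite -expfzDr ?pnatr_eq0 -?lt0n ?prime_gt0 //.
rewrite !abszM !lognM ?absz_gt0 ?numq_eq0 ?denq_eq0 //.
rewrite -/(numq x) -/(numq y) -/(denq x) -/(denq y).
by congr (_ ^ _); lia.
Qed.

Lemma padic_abs1 p : padic_abs p 1 = 1.
Proof. by rewrite -[1%R]/(1%:R) padic_abs_nat // logn1. Qed.

Lemma padic_absV p : prime p -> {morph padic_abs p : x / x^-1}.
Proof.
move=> pp x; have [->|x0] := eqVneq x 0.
  by rewrite padic_abs0 !invr0 padic_abs0.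
have e : padic_abs p x^-1 * padic_abs p x = 1.
  by rewrite -padic_absM // mulVf // padic_abs1.
have nz : padic_abs p x != 0.
  by apply: contra_eq_neq e => ->; rewrite mulr0 eq_sym oner_neq0.
by apply: (mulIf nz); rewrite e mulVf.
Qed.

Lemma padic_absXz p z : prime p -> {morph padic_abs p : x / x ^ z}.
Proof.
move=> pp x.
have X n : padic_abs p (x ^+ n) = padic_abs p x ^+ n.
  by elim: n => [|n IH]; rewrite ?padic_abs1 // !exprS padic_absM // IH.
by case: z => n; [exact: X|rewrite !NegzE -!invr_expz padic_absV // X].
Qed.

Lemma padic_abs_prod p (I : Type) (s : seq I) (F : I -> rat) : prime p ->
  padic_abs p (\prod_(i <- s) F i) = \prod_(i <- s) padic_abs p (F i).
Proof. by move=> pp; apply: big_morph;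
  [apply: padic_absM|apply: padic_abs1]. Qed.

Lemma padic_abs_le1 p (x : rat) : prime p -> x != 0 ->
  (padic_abs p x <= 1) = (logn p `|denq x| <= logn p `|numq x|)%N.
Proof.
move=> pp x0; have p1 : 1 < p%:R :> rat by rewrite ltr1n prime_gt1.
rewrite /padic_abs (negbTE x0) -[1](expr0z p%:R) ler_eXz2l //.
by rewrite subr_le0 lez_nat.
Qed.

(** A prime dividing the reduced denominator would have to divide the numerator
    as well. *)
Lemma rat_intP (x : rat) :
  reflect (forall p, prime p -> padic_abs p x <= 1) (x \is a Num.int).
Proof.
have [->|x0] := eqVneq x 0.
  by rewrite rpred0; apply: ReflectT => p _; rewrite padic_abs0.
rewrite Qint_def; apply: (iffP eqP) => [d1 p pp|xp].
  by rewrite padic_abs_le1 // d1 logn1.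
suff : `|denq x|%N = 1%N by move=> e; rewrite -[LHS]gez0_abs ?denq_ge0 // e.
apply/eqP/negPn/negP => dn1.
have pd : (pdiv `|denq x| %| `|denq x|)%N := pdiv_dvd _.
have pp : prime (pdiv `|denq x|).
  apply: pdiv_prime; have : (0 < `|denq x|)%N by rewrite absz_gt0 denq_eq0.
  by move: dn1; lia.
have := xp _ pp; rewrite padic_abs_le1 // => le.
have pn : (pdiv `|denq x| %| `|numq x|)%N.
  rewrite -[X in (X %| _)%N]expn1 pfactor_dvdn ?absz_gt0 ?numq_eq0 //.
  apply: leq_trans le; rewrite -pfactor_dvdn ?expn1 // absz_gt0 denq_eq0 //.
have := coprime_num_den x; rewrite /coprime => /eqP co.
have : (pdiv `|denq x| %| gcdn `|numq x| `|denq x|)%N by rewrite dvdn_gcd pn pd.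
by rewrite co Euclid_dvd1.
Qed.

Section Generator.
Variables (R : realType) (D : arakelov_divisor R).

(** The positive generator of H^0(O(D_finite)). *)
Definition ar_gen : rat :=
  \prod_(p <- finsupp (ar_fin D)) p%:R ^ (- ar_fin D p).

Lemma ar_gen_gt0 : 0 < ar_gen.
Proof.
rewrite /ar_gen big_seq prodr_gt0 // => p /ar_fin_prime pp.
by rewrite exprz_gt0 // ltr0n prime_gt0.
Qed.

Lemma padic_abs_ar_gen p : prime p -> padic_abs p ar_gen = p%:R ^ ar_fin D p.
Proof.
move=> pp; rewrite padic_abs_prod //.
have fac q : prime q -> padic_abs p (q%:R ^ (- ar_fin D q)) =
    if q == p then p%:R ^ ar_fin D p else 1.
  move=> qp; rewrite padic_absXz // padic_abs_nat ?prime_gt0 // logn_prime //.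
  rewrite exprz_exp; case: eqVneq => [<-|].
    by rewrite mulN1r opprK.
  by rewrite oppr0 mul0r expr0z.
rewrite big_seq (eq_bigr (fun q => if q == p then p%:R ^ ar_fin D p else 1));
  last by move=> q /ar_fin_prime /fac.
rewrite -big_seq /=.
have [pD|pD] := boolP (p \in finsupp (ar_fin D)); last rewrite (fsfun_dflt pD).
  by rewrite (bigD1_seq p) ?fset_uniq //= eqxx big1 ?mulr1 // => q /negbTE->//.
by rewrite big1 // => q _; case: eqVneq.
Qed.

Lemma expR_ar_deg : expR (ar_deg D) = expR (ar_inf D) / ratr ar_gen.
Proof.
rewrite /ar_deg expRD mulrC expR_sum; congr (_ * _).
rewrite /ar_gen rmorph_prod /= -prodfV big_seq [RHS]big_seq.
apply: eq_bigr => p /ar_fin_prime pp;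
  have p0 : 0 < p%:R :> R by rewrite ltr0n prime_gt0.
rewrite mulrC expRM lnK // powR_intmul ?ltW //.
by rewrite fmorphXz rmorph_nat -invr_expz invrK.
Qed.

(** The generator has p-adic absolute value p^(a_p) at every prime p, so q meets
    the conditions defining H^0 exactly when q / ar_gen has absolute value at
      most
    1 everywhere, that is, when it is an integer. *)
Lemma mem_H0 (x : R) : (x \in H0 D) = (x / ratr ar_gen \is a Num.int).
Proof.
have g0 : ar_gen != 0 by rewrite gt_eqF ?ar_gen_gt0.
have gR : ratr ar_gen != 0 :> R by rewrite fmorph_eq0.
have key (q : rat) : (forall p, prime p ->
  padic_abs p q <= p%:R ^ ar_fin D p) <->
    q / ar_gen \is a Num.int.
  have e p : prime p ->
      (padic_abs p (q / ar_gen) <= 1) = (padic_abs p q <= p%:R ^ ar_fin D p).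
    move=> pp; rewrite padic_absM // padic_absV // padic_abs_ar_gen //.
    by rewrite ler_pdivrMr ?mul1r // exprz_gt0 // ltr0n prime_gt0.
  by split=> [h|/rat_intP h]; [apply/rat_intP|] => p pp; have := h p pp;
    rewrite e.
apply/asboolP/idP => [[q /key/intrP[m qm] ->]|/intrP[m xm]].
  by rewrite -fmorph_div qm rmorph_int intr_int.
exists (m%:~R * ar_gen); last by rewrite rmorphM /= rmorph_int -xm divfK.
by apply/key; rewrite mulfK // intr_int.
Qed.
End Generator.

(** * Covering and counting for an infinite cyclic subgroup *)

Lemma card_nonbase k : #|{: nonbase (kplus k)}| = k.
Proof. by rewrite card_sig (cardC1 (point : 'I_k.+1)) card_ord. Qed.

(** 1/2 is a deepest point of the reals relative to the integers; this lower
    bound and the upper bound that follows determine the covering radius. *)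
Lemma half_le_int (R : realType) (m : int) : 2^-1 <= `|2^-1 - m%:~R| :> R.
Proof.
have [m0|m1] := leP m 0.
  have mR : m%:~R <= 0 :> R by rewrite lerz0.
  by rewrite ger0_norm; lra.
have mR : 1 <= m%:~R :> R by rewrite ler1z -gtz0_ge1.
by rewrite ler0_norm; lra.
Qed.

Lemma int_within_half (R : realType) (t : R) :
  exists m : int, `|t - m%:~R| <= 2^-1.
Proof.
exists (Num.floor (t + 2^-1)); have := floor_itv (t + 2^-1).
by rewrite intrD ler_norml => /andP[l u]; apply/andP; split; lra.
Qed.

Section CyclicLattice.
Variables (R : realType) (L : zmodClosed R) (g : R) (lambda : {nonneg R}).
Hypothesis g_gt0 : 0 < g.
Hypothesis memL : forall x, (x \in L) = (x / g \is a Num.int).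

(** In the l1-norm the covering radius of (gZ)^k is k g / 2: the coordinates are
    independent, each contributes at most g / 2, and the vector with all
    coordinates g / 2 attains the bound. *)
Lemma covering_radius k :
  (forall v : nonbase (kplus k) -> R,
    exists2 w, \sum_z `|w z| <= lambda%:num & forall z, v z - w z \in L) <->
  k%:R <= 2 * (lambda%:num / g).
Proof.
have g0 : g != 0 by rewrite gt_eqF.
have -> : (k%:R <= 2 * (lambda%:num / g)) = (k%:R * (g / 2) <= lambda%:num).
  by rewrite mulrA ler_pdivlMr // [2 * _]mulrC -ler_pdivrMr // mulrA.
have -> : k%:R * (g / 2) = \sum_(z : nonbase (kplus k)) g / 2.
  by rewrite sumr_const card_nonbase mulr_natl.
split=> [/(_ (fun=> g / 2))[w wl wL]|kg v].
  apply: le_trans wl; apply: ler_sum => z _.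
  have := wL z; rewrite memL => /intrP[m wm].
  have -> : w z = (2^-1 - m%:~R) * g by rewrite -wm; field.
  by rewrite normrM (gtr0_norm g_gt0) mulrC ler_pM2r // half_le_int.
have [m mP] := choice (fun z => int_within_half (v z / g)).
exists (fun z => v z - (m z)%:~R * g) => [|z]; last first.
  by rewrite opprB addrC subrK memL mulfK // intr_int.
apply: le_trans kg; apply: ler_sum => z _.
have -> : v z - (m z)%:~R * g = (v z / g - (m z)%:~R) * g by field.
by rewrite normrM (gtr0_norm g_gt0) mulrC ler_pM2l.
Qed.

(** Each coordinate of a vector in the ball is determined by its sign and by its
    absolute value, an integer at most mu. *)
Lemma finite_normHA_int (mu : {nonneg R}) k :
  finite_set [set: normHA (@intR R) mu k].
Proof.
pose n := Num.truncn mu%:num; pose enc (phi : normHA (@intR R) mu k) :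
    {ffun nonbase (kplus k) -> bool * 'I_n.+1} :=
  [ffun z => (val (val phi z) < 0, inord (Num.truncn `|val (val phi z)|))].
have inj : injective enc.
  move=> phi psi e; apply: normHA_ext => z.
  have := congr1 (fun h : {ffun _ -> _} => h z) e; rewrite !ffunE => -[es et].
  have bnd (chi : normHA (@intR R) mu k) :
      `|val (val chi z)| \is a Num.nat /\
      (Num.truncn `|val (val chi z)| < n.+1)%N.
    have cn : `|val (val chi z)| \is a Num.nat by apply/natr_norm_int/valP.
    split=> //; rewrite ltnS le_truncn //.
    apply: le_trans (valP chi); rewrite (bigD1 z) //= lerDl sumr_ge0 //.
  have [[phn phl] [psn psl]] := (bnd phi, bnd psi).
  have {et} : `|val (val phi z)| = `|val (val psi z)|.
    have := congr1 val et; rewrite /= !inordK // => et'.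
    by rewrite -(truncnK phn) -(truncnK psn) et'.
  move: es; case: ltP => [s1|s1] /esym; case: ltP => // s2 _.
    by rewrite !ltr0_norm // => /oppr_inj.
  by rewrite !ger0_norm.
(* Decoding by choice shows the ball as the image of a finite type. *)
have : finite_set [set xget point [set phi | enc phi = h] |
  h in [set: {ffun nonbase (kplus k) -> bool * 'I_n.+1}]].
  exact/finite_image/finite_finset.
apply: sub_finite_set => phi _; exists (enc phi) => //.
by case: xgetP => [psi _ /= /inj|/(_ phi)[]].
Qed.

(** Dividing by g carries the lambda-ball of (gZ)^k onto the ball of radius
    lambda / g of Z^k, and the integral part of that radius gives the same ball
    because norms of integral vectors are integers. *)
Lemma normHA_rescale (nu : {nonneg R}) k :
  nu%:num = (Num.truncn (lambda%:num / g))%:R ->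
  [set: normHA L lambda k] #= [set: normHA (@intR R) nu k].
Proof.
set n := Num.truncn _ => nuE.
have g0 : g != 0 by rewrite gt_eqF.
have key (phi : nonbase (kplus k) -> R) : (forall z, phi z / g \is a Num.int) ->
    (\sum_z `|phi z / g| <= n%:R) = (\sum_z `|phi z| <= lambda%:num).
  move=> phiL; have -> : \sum_z `|phi z| = g * \sum_z `|phi z / g|.
    rewrite mulr_sumr; apply: eq_bigr => z _.
    by rewrite normrM normfV (gtr0_norm g_gt0) mulrC divfK.
  have /natrP[N ->] : \sum_z `|phi z / g| \is a Num.nat.
    by apply: rpred_sum => z _; apply/natr_norm_int/phiL.
  rewrite ler_nat truncn_ge_nat; last by rewrite divr_ge0 // ltW.
  by rewrite [g * _]mulrC ler_pdivlMr.
have mem (phi : normHA L lambda k) z : val (val phi z) / g \is a Num.int.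
  by rewrite -memL; apply: valP.
pose dv (phi : normHA L lambda k) : HA (subgroup (@intR R)) k :=
  finfun (fun z => exist (fun a : R => is_true (a \in @intR R)) _ (mem phi z)).
have dvE phi z : val (dv phi z) = val (val phi z) / g by rewrite ffunE.
have dvP phi : norm_le nu (dv phi).
  rewrite /norm_le; under eq_bigr do rewrite dvE.
  by rewrite nuE (key (fun z => val (val phi z))) //; apply: (valP phi).
pose F phi : normHA (@intR R) nu k :=
  exist (fun phi => is_true (norm_le nu phi)) _ (dvP phi).
have inj : injective F.
  move=> phi psi e; apply: normHA_ext => z; apply: (mulIf (invr_neq0 g0)).
  by rewrite -!dvE -[dv phi]/(val (F phi)) e.
have surj psi : exists phi, F phi = psi.
  have ml z : val (val psi z) * g \in L.
    by rewrite memL mulfK //; apply: (valP (val psi z)).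
  pose phi : HA (subgroup L) k :=
    finfun (fun z => exist (fun a : R => is_true (a \in L)) _ (ml z)).
  have phiE z : val (phi z) = val (val psi z) * g by rewrite ffunE.
  have phiP : norm_le lambda phi.
    rewrite /norm_le; under eq_bigr do rewrite phiE.
    rewrite -key => [|z]; last by rewrite -memL.
    by rewrite -nuE; under eq_bigr do rewrite mulfK //; apply: (valP psi).
  exists (exist (fun phi => is_true (norm_le lambda phi)) _ phiP).
  by apply: normHA_ext => z; rewrite dvE /= phiE mulfK.
apply/card_set_bijP; exists F; rewrite setTT_bijective.
exact: inj_surj_bijective inj surj.
Qed.

Lemma normHA_card k :
  [set: normHA L lambda k] #= `I_(gamma R (Num.truncn (lambda%:num / g)) k).
Proof.
have [m Am] := finite_normHA_int
  ((Num.truncn (lambda%:num / g))%:R%:nng : {nonneg R}) k.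
apply: card_eq_trans (normHA_rescale _ _) _;
  last by rewrite /gamma (card_fset_set Am); exact: Am.
by [].
Qed.

End CyclicLattice.

Theorem proposition4p12 (R : realType) (D : arakelov_divisor R) :
  [/\ (forall k : nat,
         equivalence (sph (HD D k) 1) (@piR (HD D k) 1)) /\
      smodule_iso (pi_smodule 1 (HD D))
        (normHA_smodule (H0 D) (expR (ar_inf D))%:nng),
      forall k : nat,
        [set: pi_smodule 1 (HD D) k] #=
          `I_(gamma R (Num.truncn (expR (ar_deg D))) k),
      forall k : nat,
        pi_trivial (HD D k) 0 <-> k%:R <= 2 * expR (ar_deg D)
    & forall n k : nat, (1 < n)%N -> pi_trivial (HD D k) n ].
Proof.
have gR : 0 < ratr (ar_gen D) :> R by rewrite ltr0q ar_gen_gt0.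
split.
- by split; [move=> k; apply: piR1_equivalence|apply: pi1_iso].
- move=> k; rewrite expR_ar_deg.
  apply: card_eq_trans (normHA_card (expR (ar_inf D))%:nng gR (@mem_H0 R D) k).
  have [F [bF _]] := pi1_iso (H0 D) (expR (ar_inf D))%:nng.
  by apply/card_set_bijP; exists (F k); rewrite setTT_bijective; apply: bF.
- move=> k; rewrite expR_ar_deg; apply: iff_trans (pi0_trivialP _ _ _) _.
  exact: (covering_radius (expR (ar_inf D))%:nng gR (@mem_H0 R D)).
- by move=> n k; apply: pi_ge2_trivial.
Qed.
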